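(* For any $k$-partition with sinks $\{\hat P,\hat Y\}$ there exists a worst-case scenario $s^*\in\mathcal S$ for $\{\hat P,\hat Y\}$, with dominant part $P_d$, such that (1) $w_i(s^* )=w_i^-$ whenever $x_i\notin P_d$, and (2) the sub-scenario of $s^*$ within $P_d$ is left-dominant or right-dominant.
   Context: $P$ is a path with vertices at coordinates $x_0<\dots<x_n$; $\tau>0$. Vertex $x_i$ has weight interval $[w_i^-,w_i^+]$, $0<w_i^-\le w_i^+$; a scenario $s$ assigns $w_i(s)\in[w_i^-,w_i^+]$, and $\mathcal S$ is the set of scenarios. For a subpath $Q=\{x_l,\dots,x_r\}$, sink $y=x_t\in Q$: $\Theta_L(Q,y,s)=\max_{l\le i<t}\{(x_t-x_i)\tau+\sum_{j=l}^i w_j(s)\}$, $\Theta_R(Q,y,s)=\max_{t<i\le r}\{(x_i-x_t)\tau+\sum_{j=i}^r w_j(s)\}$ (empty maxima $0$), $\Theta^1=\max(\Theta_L,\Theta_R)$. A $k$-partition with sinks: consecutive subpaths $P_1,\dots,P_k$ partitioning the vertices with sinks $y_i\in P_i$. $\Theta^k(P,\{\hat P,\hat Y\},s)=\max_i\Theta^1(P_i,y_i,s)$; $\Theta^k_{\rm opt}(P,s)$ its minimum over all $k$-partitions with sinks; regret $=\Theta^k-\Theta^k_{\rm opt}$; a worst-case scenario maximizes regret over $\mathcal S$. Dominant part: $P_d$, $d$ the smallest index maximizing $\Theta^1(P_i,y_i,s)$. A sub-scenario on $\{x_l,\dots,x_r\}$ is left-dominant (resp. right-dominant) if for some $l\le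 i\le r$, $w_j(s)=w_j^+$ (resp. $w_j^-$) for $l\le j<i$ and $w_j(s)=w_j^-$ (resp. $w_j^+$) for $i\le j\le r$. *)

(* Defs.v *)
From HB Require Import structures.
From mathcomp Require Import all_boot all_order all_algebra.
From mathcomp Require Import reals.

Set Implicit Arguments.
Unset Strict Implicit.
Unset Printing Implicit Defensive.

Import Order.TTheory GRing.Theory Num.Theory.
Local Open Scope ring_scope.

(* Minimum of a real function over a finite type.  The pick only supplies an   *)
(* element of the family to start the iteration; the value 0 is used only if T *)
(* is empty.                                                                   *)
Definition fmin (R : realType) (T : finType) (f : T -> R) : R :=
  if [pick t : T] is Some t0 then \big[Num.min/f t0]_(t : T) f t else 0.

Lemma fmin_le (R : realType) (T : finType) (f : T -> R) (t : T) : fmin f <= f t.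
Proof.
rewrite /fmin; case: pickP => [t0 _|/(_ t)//].
by rewrite (bigD1 t) //= ge_min lexx.
Qed.

Lemma fmin_attained (R : realType) (T : finType) (f : T -> R) (t : T) :
  exists u, fmin f = f u.
Proof.
rewrite /fmin; case: pickP => [t0 _|/(_ t)//].
elim/big_ind: _ => [|a b [u ->] [v ->]|u _]; first by exists t0.
  by case: leP => _; [exists u | exists v].
by exists u.
Qed.

(* Vertices are identified with their indices 0, ..., n.  Part i of a          *)
(* k-partition with sinks is encoded by the triple (l, t, r) of the indices of *)
(* its first vertex, its sink and its last vertex.                             *)
Definition is_kpart (n k : nat)
    (p : {ffun 'I_k -> 'I_n.+1 * 'I_n.+1 * 'I_n.+1}) : bool :=
  [&& [forall i, (p i).1.1 <= (p i).1.2 <= (p i).2]%N,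
      [forall i : 'I_k, forall j : 'I_k,
         (i < j)%N ==> ((p i).2 < (p j).1.1)%N]
    & [forall v : 'I_n.+1, exists i, ((p i).1.1 <= v <= (p i).2)%N]].

Record kpart (n k : nat) := KPart {
  kpart_val :> {ffun 'I_k -> 'I_n.+1 * 'I_n.+1 * 'I_n.+1};
  _ : is_kpart kpart_val }.

HB.instance Definition _ n k := [isSub for @kpart_val n k].
HB.instance Definition _ n k := [Finite of kpart n k by <:].

Definition lft n k (p : kpart n k) (i : 'I_k) : 'I_n.+1 := (p i).1.1.
Definition sink n k (p : kpart n k) (i : 'I_k) : 'I_n.+1 := (p i).1.2.
Definition rgt n k (p : kpart n k) (i : 'I_k) : 'I_n.+1 := (p i).2.

Definition in_part n k (p : kpart n k) (i : 'I_k) (v : 'I_n.+1) : bool :=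
  (lft p i <= v <= rgt p i)%N.

Section Evacuation.
Variables (R : realType) (n : nat).
Implicit Types (x s wlo whi : 'I_n.+1 -> R) (tau : R) (l t r : 'I_n.+1).

(* For increasing x and nonnegative tau and s, every term of the maxima below  *)
(* is nonnegative, so starting them at 0 matters only for an empty range.      *)
Definition ThetaL x tau s l t : R :=
  \big[Num.max/0]_(i : 'I_n.+1 | (l <= i < t)%N)
    ((x t - x i) * tau + \sum_(j : 'I_n.+1 | (l <= j <= i)%N) s j).

Definition ThetaR x tau s t r : R :=
  \big[Num.max/0]_(i : 'I_n.+1 | (t < i <= r)%N)
    ((x i - x t) * tau + \sum_(j : 'I_n.+1 | (i <= j <= r)%N) s j).

Definition Theta1 x tau s l t r : R :=
  Num.max (ThetaL x tau s l t) (ThetaR x tau s t r).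

Definition Theta_part x tau k (p : kpart n k) s (i : 'I_k) : R :=
  Theta1 x tau s (lft p i) (sink p i) (rgt p i).

Definition Thetak x tau k (p : kpart n k) s : R :=
  \big[Num.max/0]_(i < k) Theta_part x tau p s i.

Definition Thetak_opt x tau k s : R :=
  fmin (fun q : kpart n k => Thetak x tau q s).

Definition regret x tau k (p : kpart n k) s : R :=
  Thetak x tau p s - Thetak_opt x tau k s.

Definition scenario wlo whi s : Prop := forall i, wlo i <= s i <= whi i.

Definition worst_case x tau wlo whi k (p : kpart n k) s : Prop :=
  scenario wlo whi s /\
  forall s', scenario wlo whi s' -> regret x tau p s' <= regret x tau p s.

Definition maximizing_part x tau k (p : kpart n k) s (d : 'I_k) : Prop :=
  forall i, Theta_part x tau p s i <= Theta_part x tau p s d.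

Definition dominant_part x tau k (p : kpart n k) s (d : 'I_k) : Prop :=
  maximizing_part x tau p s d /\
  forall j : 'I_k, maximizing_part x tau p s j -> (d <= j)%N.

Definition left_dominant wlo whi s l r : Prop :=
  exists i : 'I_n.+1, [/\ (l <= i <= r)%N,
    forall j : 'I_n.+1, (l <= j < i)%N -> s j = whi j &
    forall j : 'I_n.+1, (i <= j <= r)%N -> s j = wlo j].

Definition right_dominant wlo whi s l r : Prop :=
  exists i : 'I_n.+1, [/\ (l <= i <= r)%N,
    forall j : 'I_n.+1, (l <= j < i)%N -> s j = wlo j &
    forall j : 'I_n.+1, (i <= j <= r)%N -> s j = whi j].

End Evacuation.

(* Main.v *)
Require Import Defs.
From HB Require Import structures.
From mathcomp Require Import all_boot all_order all_algebra.
From mathcomp Require Import reals.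

Set Implicit Arguments.
Unset Strict Implicit.
Unset Printing Implicit Defensive.

Import Order.TTheory GRing.Theory Num.Theory.
Local Open Scope ring_scope.

(** Let [d] be the dominant part of a scenario [s].  Its cost is a single term
    (distance plus the weights of a prefix or a suffix [U] of the part), or 0.
    Raising [s] to the upper bounds on [U] and lowering it to the lower bounds
    elsewhere raises that term by the total increase on [U], whereas the optimum
    rises by at most as much, since every cost counts each weight at most once.
    So the regret does not drop.  No other part becomes more expensive, so [d]
    stays dominant.  The scenarios obtained in this way form a finite family:
    modifying once more one of largest regret gives the worst case. *)

Lemma bigmax0_attained (R : realType) (T : finType) (P : pred T) (F : T -> R) :
  \big[Num.max/0]_(i | P i) F i = 0 \/
  exists2 i, P i & \big[Num.max/0]_(i | P i) F i = F i.
Proof.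
elim/big_ind: _ => [|a b Ha Hb|i Pi]; [by left | | by right; exists i].
by case: leP.
Qed.

Section Costs.
Variables (R : realType) (n : nat) (x : 'I_n.+1 -> R) (tau : R).
Implicit Types (s c D : 'I_n.+1 -> R) (l t r i j : 'I_n.+1).

Lemma ThetaL_ge_term s l t i : (l <= i < t)%N ->
  (x t - x i) * tau + \sum_(j : 'I_n.+1 | (l <= j <= i)%N) s j
    <= ThetaL x tau s l t.
Proof. by move=> lit; apply: le_bigmax_cond. Qed.

Lemma ThetaR_ge_term s t r i : (t < i <= r)%N ->
  (x i - x t) * tau + \sum_(j : 'I_n.+1 | (i <= j <= r)%N) s j
    <= ThetaR x tau s t r.
Proof. by move=> tir; apply: le_bigmax_cond. Qed.

Lemma Theta1_ge0 s l t r : 0 <= Theta1 x tau s l t r.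
Proof. by rewrite le_max /ThetaL bigmax_ge_id. Qed.

(** Since [D] is nonnegative, its sum over [P] may be extended to all vertices; the error term then
    no longer depends on [P]. *)
Lemma ler_sum_cond_add s c D (P : pred 'I_n.+1) :
  (forall j, 0 <= D j) -> (forall j, P j -> c j <= s j + D j) ->
  \sum_(j | P j) c j <= \sum_(j | P j) s j + \sum_j D j.
Proof.
move=> D0 cs; apply: (@le_trans _ _ (\sum_(j | P j) (s j + D j))).
  exact: ler_sum.
rewrite big_split lerD2l (bigID P predT) /= lerDl.
by apply: sumr_ge0.
Qed.

(** Each term of either maximum sums weights of distinct vertices between [l] and [r], so it grows
    by at most the total of [D]. *)
Lemma Theta1_le_add s c D l t r : (l <= t <= r)%N ->
  (forall j, 0 <= D j) ->
  (forall j, (l <= j <= r)%N -> c j <= s j + D j) ->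
  Theta1 x tau c l t r <= Theta1 x tau s l t r + \sum_j D j.
Proof.
move=> /andP[lt tr] D0 cs.
have T0 : 0 <= Theta1 x tau s l t r + \sum_j D j.
  by rewrite addr_ge0 ?Theta1_ge0 ?sumr_ge0.
rewrite {1}/Theta1 ge_max; apply/andP; split; apply: bigmax_le => // i.
- move=> lit; have /andP[li it] := lit.
  apply: (@le_trans _ _ (ThetaL x tau s l t + \sum_j D j)); last first.
    by rewrite lerD2r le_max lexx.
  apply: le_trans (lerD (ThetaL_ge_term s lit) (lexx _)).
  rewrite -addrA lerD2l; apply: ler_sum_cond_add => // j /andP[lj ji].
  by apply: cs; rewrite lj (leq_trans ji) // (leq_trans (ltnW it)).
- move=> tir; have /andP[ti ir] := tir.
  apply: (@le_trans _ _ (ThetaR x tau s t r + \sum_j D j)); last first.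
    by rewrite lerD2r le_max lexx orbT.
  apply: le_trans (lerD (ThetaR_ge_term s tir) (lexx _)).
  rewrite -addrA lerD2l; apply: ler_sum_cond_add => // j /andP[ij jr].
  by apply: cs; rewrite jr (leq_trans lt) // (leq_trans (ltnW ti)).
Qed.

Variable k : nat.
Implicit Types (p q : kpart n k) (d e : 'I_k).

Lemma kpart_bounds p d : (lft p d <= sink p d <= rgt p d)%N.
Proof. by case: p => q qP; case/and3P: (qP) => /forallP/(_ d). Qed.

Lemma kpart_disjoint p d e j : in_part p d j -> in_part p e j -> d = e.
Proof.
have lt_parts (a b : 'I_k) : (a < b)%N -> (rgt p a < lft p b)%N.
  by case: p => q qP; case/and3P: (qP) => _ /forallP/(_ a)/forallP/(_ b)/implyP.
move=> /andP[dj jd] /andP[ej je]; apply/val_inj.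
have [/lt_parts lt_de|/lt_parts lt_ed|//] := ltngtP d e.
- by have := leq_trans lt_de (leq_trans ej jd); rewrite ltnn.
- by have := leq_trans lt_ed (leq_trans dj je); rewrite ltnn.
Qed.

Lemma Theta_part_ge0 p s d : 0 <= Theta_part x tau p s d.
Proof. exact: Theta1_ge0. Qed.

Lemma Theta_part_le_add p s c D d :
  (forall j, 0 <= D j) ->
  (forall j, in_part p d j -> c j <= s j + D j) ->
  Theta_part x tau p c d <= Theta_part x tau p s d + \sum_j D j.
Proof. by move=> D0 cs; apply: Theta1_le_add => //; apply: kpart_bounds. Qed.

Lemma Theta_part_le p s c d : (forall j, in_part p d j -> c j <= s j) ->
  Theta_part x tau p c d <= Theta_part x tau p s d.
Proof.
move=> cs; have := @Theta_part_le_add p s c (fun=> 0) d (fun=> lexx _).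
by rewrite big1 // addr0; apply=> j /cs; rewrite addr0.
Qed.

Lemma Theta_part_le_Thetak p s d : Theta_part x tau p s d <= Thetak x tau p s.
Proof. exact: le_bigmax. Qed.

Lemma Thetak_maximizing p s d : maximizing_part x tau p s d ->
  Thetak x tau p s = Theta_part x tau p s d.
Proof.
move=> maxd; apply/eqP; rewrite eq_le Theta_part_le_Thetak andbT.
by apply: bigmax_le => //; apply: Theta_part_ge0.
Qed.

Lemma Thetak_le_add q s c D : (forall j, 0 <= D j) ->
  (forall j, c j <= s j + D j) ->
  Thetak x tau q c <= Thetak x tau q s + \sum_j D j.
Proof.
move=> D0 cs; apply: bigmax_le => [|i _].
  by rewrite addr_ge0 ?bigmax_ge_id ?sumr_ge0.
apply: le_trans (Theta_part_le_add D0 (fun j _ => cs j)) _.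
by rewrite lerD2r Theta_part_le_Thetak.
Qed.

(** A partition optimal for [s] is a candidate for [c]. The argument [p] ensures that there is a
    [k]-partition, so that the minimum is attained. *)
Lemma Thetak_opt_le_add (p : kpart n k) s c D : (forall j, 0 <= D j) ->
  (forall j, c j <= s j + D j) ->
  Thetak_opt x tau k c <= Thetak_opt x tau k s + \sum_j D j.
Proof.
move=> D0 cs; rewrite /Thetak_opt.
have [q ->] := fmin_attained (fun q : kpart n k => Thetak x tau q s) p.
exact: le_trans (fmin_le _ q) (Thetak_le_add q D0 cs).
Qed.

Lemma exists_dominant_part p s : exists d, dominant_part x tau p s d.
Proof.
(* The part containing vertex 0 shows that ['I_k] is inhabited. *)
have [d0 _] : exists d, in_part p d ord0.
  by case: p => q qP; case/and3P: (qP) => _ _ /forallP/(_ ord0)/existsP.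
pose F := Theta_part x tau p s; pose M d := [forall e, F e <= F d].
have [d1 /forallP Md1] : exists d, M d.
  case: (Order.TotalTheory.arg_maxP F (erefl : xpredT d0)) => d _ maxd.
  by exists d; apply/forallP => e; apply: maxd.
have Md1b : M d1 by apply/forallP.
case: (arg_minnP (fun d : 'I_k => d : nat) Md1b) => d /forallP Md mind.
by exists d; split=> // j Mj; apply: mind; apply/forallP.
Qed.

Variables (wlo whi : 'I_n.+1 -> R).

Definition extreme (U : pred 'I_n.+1) j : R := if U j then whi j else wlo j.

Lemma extreme_scenario U : (forall j, wlo j <= whi j) ->
  scenario wlo whi (extreme U).
Proof. by move=> le_w j; rewrite /extreme; case: ifP => _; rewrite lexx le_w. Qed.

Lemma extreme_dominant_regret p s d (U : pred 'I_n.+1) :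
  scenario wlo whi s -> dominant_part x tau p s d ->
  (forall j, U j -> in_part p d j) ->
  Theta_part x tau p s d + \sum_(j | U j) (whi j - s j)
    <= Theta_part x tau p (extreme U) d ->
  dominant_part x tau p (extreme U) d /\
  regret x tau p s <= regret x tau p (extreme U).
Proof.
move=> ss [maxd mind] Ud; rewrite big_mkcond /=.
(* [D] records the increases only: off [U] the weights do not rise, so 0 bounds the change there. *)
pose D j := if U j then whi j - s j else 0; rewrite -/(\sum_j D j) => gain.
have D0 j : 0 <= D j.
  by rewrite /D; case: ifP => // _; rewrite subr_ge0; have /andP[] := ss j.
have cs j : extreme U j <= s j + D j.
  rewrite /extreme /D; case: ifP => _; first by rewrite addrC subrK.
  by rewrite addr0; have /andP[] := ss j.
have le_d : Theta_part x tau p s d <= Theta_part x tau p (extreme U) d.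
  by apply: le_trans gain; rewrite lerDl; apply: sumr_ge0.
have le_other e : e != d ->
    Theta_part x tau p (extreme U) e <= Theta_part x tau p s e.
  move=> ed; apply: Theta_part_le => j ej; rewrite /extreme.
  case: ifP => [/Ud dj|_]; last by have /andP[] := ss j.
  by rewrite (kpart_disjoint ej dj) eqxx in ed.
have maxd' : maximizing_part x tau p (extreme U) d.
  move=> e; have [->//|ed] := eqVneq e d.
  exact: le_trans (le_other e ed) (le_trans (maxd e) le_d).
split.
  (* A part [e] other than [d] that is maximizing now was already maximizing under [s], because its
     cost has not risen and that of [d] has not dropped. Hence [d <= e]. *)
  split=> // e maxe; have [->//|ed] := eqVneq e d.
  apply: mind => i; apply: le_trans (maxd i) _.
  exact: le_trans le_d (le_trans (maxe d) (le_other e ed)).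
rewrite /regret lerBlDr addrAC lerBrDr (Thetak_maximizing maxd).
rewrite (Thetak_maximizing maxd').
apply: le_trans (lerD (lexx _) (Thetak_opt_le_add p D0 cs)) _.
by rewrite addrCA [leRHS]addrC lerD2l.
Qed.

(** The triple gives the part, the side ([true] for a prefix) and the cut vertex, which belongs to
    the suffix. Triples form a finite type, so a maximum over them exists. *)
Definition cut_set p (c : 'I_k * bool * 'I_n.+1) : pred 'I_n.+1 :=
  fun j => in_part p c.1.1 j && (if c.1.2 then j < c.2 else c.2 <= j)%N.

Lemma term_gain s (U P : pred 'I_n.+1) (a : R) : U =1 P ->
  a + \sum_(j | P j) s j + \sum_(j | U j) (whi j - s j)
  = a + \sum_(j | P j) extreme U j.
Proof.
move=> UP; rewrite -addrA (eq_bigl _ _ UP) -big_split /=; congr (_ + _).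
by apply: eq_bigr => j; rewrite /extreme UP => ->; rewrite addrC subrK.
Qed.

(** The vertices whose weights enter the attained term form a prefix or a suffix of the dominant
    part; this is the set to raise. *)
Lemma cut_improves p s : scenario wlo whi s ->
  exists c : 'I_k * bool * 'I_n.+1,
  [/\ in_part p c.1.1 c.2,
      dominant_part x tau p (extreme (cut_set p c)) c.1.1 &
      regret x tau p s <= regret x tau p (extreme (cut_set p c))].
Proof.
move=> ss; have [d domd] := exists_dominant_part p s.
have /andP[lt tr] := kpart_bounds p d.
suff [b [i di gain]] : exists b, exists2 i, in_part p d i &
    Theta_part x tau p s d + \sum_(j | cut_set p (d, b, i) j) (whi j - s j)
    <= Theta_part x tau p (extreme (cut_set p (d, b, i))) d.
  exists (d, b, i).
  have [] // := extreme_dominant_regret (U := cut_set p (d, b, i)) ss domd _ gain.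
  by move=> j /andP[].
(* At cost 0, cutting at the first vertex raises nothing, and the gain reduces to nonnegativity of
   the new cost. *)
have zero_case : Theta_part x tau p s d = 0 -> exists b, exists2 i, in_part p d i &
    Theta_part x tau p s d + \sum_(j | cut_set p (d, b, i) j) (whi j - s j)
    <= Theta_part x tau p (extreme (cut_set p (d, b, i))) d.
  move=> ->; exists true, (lft p d).
    by rewrite /in_part leqnn (leq_trans lt).
  rewrite add0r big_pred0 ?Theta_part_ge0 // => j.
  by rewrite /cut_set /in_part /=; case: ltnP => [|_]; rewrite ?andbF //; case: leqP.
case: (lerP (ThetaR x tau s (sink p d) (rgt p d))
            (ThetaL x tau s (lft p d) (sink p d))) => [leRL|/ltW leLR].
- have ThE : Theta_part x tau p s d = ThetaL x tau s (lft p d) (sink p d).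
    exact/max_idPl.
  have [T0|[i lit TE]] := bigmax0_attained (fun i => (lft p d <= i < sink p d)%N)
    (fun i => (x (sink p d) - x i) * tau
              + \sum_(j : 'I_n.+1 | (lft p d <= j <= i)%N) s j).
    by apply: zero_case; rewrite ThE.
  have /andP[li it] := lit; have ir := leq_trans it tr.
  (* The term includes the weight of [i] while a prefix stops before its cut, so the cut is [i.+1].
     It stays in the part because [i] precedes the sink. *)
  have i1 : (i.+1 < n.+1)%N by apply: leq_ltn_trans ir (ltn_ord _).
  exists true, (Ordinal i1).
    by rewrite /in_part /= (leq_trans li).
  rewrite ThE /ThetaL TE term_gain.
    by rewrite le_max ThetaL_ge_term.
  move=> j; rewrite /cut_set /in_part /= ltnS.
  case: (leqP j i) => [ji|]; rewrite ?andbT ?andbF //.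
  by rewrite (leq_trans ji (ltnW ir)) andbT.
- have ThE : Theta_part x tau p s d = ThetaR x tau s (sink p d) (rgt p d).
    exact/max_idPr.
  have [T0|[i tir TE]] := bigmax0_attained (fun i => (sink p d < i <= rgt p d)%N)
    (fun i => (x i - x (sink p d)) * tau
              + \sum_(j : 'I_n.+1 | (i <= j <= rgt p d)%N) s j).
    by apply: zero_case; rewrite ThE.
  have /andP[ti ir] := tir; have li := leq_trans lt (ltnW ti).
  exists false, i; first by rewrite /in_part li.
  rewrite ThE /ThetaR TE term_gain.
    by rewrite le_max ThetaR_ge_term ?orbT.
  move=> j; rewrite /cut_set /in_part /=.
  case: (leqP i j) => [ij|]; rewrite ?andbT ?andbF //.
  by rewrite (leq_trans li ij).
Qed.

End Costs.

Theorem theorem1 (R : realType) (n k : nat) (x : 'I_n.+1 -> R) (tau : R)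
    (wlo whi : 'I_n.+1 -> R)
    (x_incr : forall i j : 'I_n.+1, (i < j)%N -> x i < x j)
    (tau_gt0 : 0 < tau)
    (w_bounds : forall i : 'I_n.+1, 0 < wlo i <= whi i)
    (p : kpart n k) :
  exists (s : 'I_n.+1 -> R) (d : 'I_k),
    [/\ worst_case x tau wlo whi p s,
        dominant_part x tau p s d,
        forall i : 'I_n.+1, ~~ in_part p d i -> s i = wlo i &
        left_dominant wlo whi s (lft p d) (rgt p d) \/
        right_dominant wlo whi s (lft p d) (rgt p d)].
Proof.
have le_w j : wlo j <= whi j by case/andP: (w_bounds j).
pose sc c := extreme wlo whi (cut_set p c).
have scS c : scenario wlo whi (sc c) by apply: extreme_scenario.
(* Applied to the scenario of all lower bounds, this provides a triple, so the maximum below is over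
   a nonempty family. *)
have [c0 _] := cut_improves x tau p (extreme_scenario xpred0 le_w).
have [cm maxm] : exists cm, forall c,
    regret x tau p (sc c) <= regret x tau p (sc cm).
  have := Order.TotalTheory.arg_maxP (fun c => regret x tau p (sc c))
    (erefl : xpredT c0).
  by case=> cm _ maxm; exists cm => c; apply: maxm.
(* The part named in [cm] need not be dominant, nor contain the cut. A second improvement secures
   both and keeps the regret maximal. *)
have [[[d b] i] /= [di domd le_reg]] := cut_improves x tau p (scS cm).
exists (sc (d, b, i)), d; split=> //.
(* Any scenario is matched or beaten by a member of the finite family, hence by the chosen one. *)
- split=> // s' /(cut_improves x tau p)[c [_ _ le_c]].
  exact: le_trans le_c (le_trans (maxm c) le_reg).
- by move=> j /negbTE dj; rewrite /sc /extreme /cut_set /= dj.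
have /andP[li ir] := di.
case: b {domd le_reg}; [left | right]; exists i; split=> // j /andP[h1 h2];
  rewrite /sc /extreme /cut_set /in_part /=.
- by rewrite h1 h2 (leq_trans (ltnW h2)).
- by rewrite ltnNge h1 andbF.
- by rewrite [(i <= j)%N]leqNgt h2 andbF.
- by rewrite h1 h2 (leq_trans li).
Qed.
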